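(* Let $P_1$ be the uniform distribution on $[0,\frac12]$, let $D=\{\frac23,\frac56,1\}$, let $P_2$ be the uniform discrete distribution on $D$ (mass $\frac13$ at each point), and let $P=\frac12P_1+\frac12P_2$. Let $n\in\mathbb N$ with $n\ge 5$, let $\alpha_n(P)$ be an optimal set of $n$-means for $P$, and let $\alpha_{n-3}(P_1)$ be the optimal set of $(n-3)$-means for $P_1$. Then $$\alpha_n(P)=\alpha_{n-3}(P_1)\cup D\quad\text{and}\quad V_n(P)=\tfrac12V_{n-3}(P_1).$$
   Context: For a Borel probability measure $Q$ on $\mathbb R$ with finite second moment and a finite nonempty set $\alpha\subset\mathbb R$, put $V(Q;\alpha)=\int\min_{a\in\alpha}(x-a)^2\,dQ(x)$. The $n$th quantization error is $V_n(Q)=\inf\{V(Q;\alpha):\alpha\subset\mathbb R,\ 1\le\mathrm{card}(\alpha)\le n\}$. A set $\alpha$ with $1\le \mathrm{card}(\alpha)\le n$ is an optimal set of $n$-means for $Q$ if $V(Q;\alpha)=V_n(Q)$. For the uniform distribution $P_1$ on $[0,\frac12]$ the optimal set of $m$-means is unique, namely $\{\frac{2i-1}{4m}:1\le i\le m\}$, with $V_m(P_1)=\frac1{48m^2}$. *)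

(* Defs.v *)
From HB Require Import structures.
From mathcomp Require Import all_boot all_order all_algebra finmap.
From mathcomp Require Import all_classical all_reals all_analysis.

Set Implicit Arguments.
Unset Strict Implicit.
Unset Printing Implicit Defensive.

Import Order.TTheory GRing.Theory Num.Theory.
Import numFieldNormedType.Exports.

Local Open Scope classical_set_scope.
Local Open Scope ring_scope.

Section quantization.
Context {R : realType}.
Implicit Types (Q : probability (measurableTypeR R) R) (alpha : {fset R}).

(* The unit +oo of mine only shows for alpha empty, which is excluded below.
   The value is in \bar R: it is finite for alpha nonempty exactly when Q has
   a finite second moment. *)
Definition distortion Q alpha : \bar R :=
  (\int[Q]_x \big[mine/+oo]_(a <- alpha) ((x - a) ^+ 2)%:E)%E.

Definition quant_error Q (n : nat) : \bar R :=
  ereal_inf [set distortion Q alpha | alpha in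
    [set alpha : {fset R} | (1 <= #|` alpha| <= n)%N]].

Definition optimal_nmeans Q (n : nat) alpha : Prop :=
  (1 <= #|` alpha| <= n)%N /\ distortion Q alpha = quant_error Q n.

End quantization.

Section uniform_fset.
Context (R : realType) (A : {fset R}).

Definition uniform_fset (A0 : A != fset0) : set (measurableTypeR R) -> \bar R :=
  mscale (#|` A|%:R^-1)%:nng
    (msum (fun k => dirac (nth 0 A k : measurableTypeR R)) #|` A|).

Variable A0 : A != fset0.

HB.instance Definition _ := Measure.on (uniform_fset A0).

Let uniform_fset_setT : uniform_fset A0 setT = 1%E.
Proof.
rewrite /uniform_fset /mscale /= /msum.
rewrite (eq_bigr (fun=> 1%E)); last by move=> k _; rewrite /= /dirac indicT.
rewrite sumEFin -EFinM sumr_const card_ord mulVf//.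
by rewrite pnatr_eq0 cardfs_eq0.
Qed.

HB.instance Definition _ :=
  @Measure_isProbability.Build _ _ R (uniform_fset A0) uniform_fset_setT.

End uniform_fset.

Section distributions.
Context (R : realType).

Lemma half_gt0 : 0 < 2^-1 :> R.
Proof. by rewrite invr_gt0. Qed.

Definition P1 : probability (measurableTypeR R) R := uniform_prob half_gt0.

Definition D : {fset R} := [fset 2 / 3; 5 / 6; 1]%fset.

Lemma D_neq0 : D != fset0.
Proof. by apply/fset0Pn; exists 1; rewrite !inE eqxx !orbT. Qed.

Definition P2 : probability (measurableTypeR R) R := uniform_fset D_neq0.

Definition mixture : set (measurableTypeR R) -> \bar R :=
  measure_add (mscale (2^-1)%:nng P1) (mscale (2^-1)%:nng P2).

HB.instance Definition _ := Measure.on mixture.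

Let mixture_setT : mixture setT = 1%E.
Proof.
have -> : mixture setT = (2^-1%:E * P1 setT + 2^-1%:E * P2 setT)%E.
  exact: measure_addE.
rewrite !probability_setT !mule1 -EFinD.
by rewrite [in RHS](splitr 1) !div1r.
Qed.

HB.instance Definition _ :=
  @Measure_isProbability.Build _ _ R mixture mixture_setT.

Definition P : probability (measurableTypeR R) R := mixture.

End distributions.

(* Main.v *)
Require Import Defs.
From mathcomp Require Import all_boot all_order all_algebra finmap.
From mathcomp Require Import all_classical all_reals all_analysis.
From mathcomp Require Import measurable_realfun.
From mathcomp Require Import ring lra.

(* For every h > 0 the squared distance from x to a finite set S is at least
   h^2 - \sum_(a in S) max(0, h^2 - (x - a)^2).  Integrating over [0, 1/2], each
   summand contributes at most 4/3 h^3, with equality iff [a - h, a + h] lies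
   in [0, 1/2].  With h = 1/(4m) this gives h^2/6 as a lower bound for m points,
   attained iff the intervals [a - h, a + h] tile [0, 1/2].
   For the mixture, take a nearest point of S to each of the three atoms.  If
   these points are distinct, the gain each of them brings on [0, 1/2] does not
   make up for its distance to the atom, so n - 3 points remain for [0, 1/2].
   If two atoms share a nearest point, the resulting loss of 1/432 exceeds what
   can be gained on [0, 1/2] by the spare points, as soon as m >= 2. *)

Import Order.TTheory GRing.Theory Num.Theory.
Import numFieldNormedType.Exports.

Local Open Scope ring_scope.

Set Implicit Arguments.
Unset Strict Implicit.
Unset Printing Implicit Defensive.

(** * Squared distance to a finite set *)

(* The default value of the minimum is itself one of its terms, so this is the
   true minimum for S nonempty (and junk for S empty). *)
Definition sqdist (R : realType) (S : {fset R}) (x : R) : R :=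
  \big[Num.min/(x - head 0 S) ^+ 2]_(a <- S) (x - a) ^+ 2.

(** The minimum with a finite [y] absorbs the unit [+oo], which lets the induction start at the
    empty list. *)
Lemma bigmine_EFin (R : realType) (s : seq R) (f : R -> R) (y : R) :
  (mine y%:E (\big[mine/+oo]_(a <- s) (f a)%:E) =
   (\big[Num.min/y]_(a <- s) f a)%:E)%E.
Proof.
elim: s => [|b s IHs]; first by rewrite !big_nil miney.
by rewrite !big_cons minCA IHs EFin_min.
Qed.

Lemma bigmine_sqdist (R : realType) (S : {fset R}) (x : R) : S != fset0 ->
  (\big[mine/+oo]_(a <- S) ((x - a) ^+ 2)%:E = (sqdist S x)%:E)%E.
Proof.
rewrite -cardfs_gt0 /sqdist; case: (S : seq R) => [//|b s] _ /=.
by rewrite -bigmine_EFin big_cons minA minxx.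
Qed.

Lemma sqdist_le (R : realType) (S : {fset R}) (x a : R) :
  a \in S -> sqdist S x <= (x - a) ^+ 2.
Proof. by move=> aS; rewrite /sqdist; apply: ge_bigmin_seq. Qed.

Lemma sqdist_attained (R : realType) (S : {fset R}) (x : R) : S != fset0 ->
  exists2 a, a \in S & sqdist S x = (x - a) ^+ 2.
Proof.
move=> S0; have hS : head 0 S \in S.
  have: head 0 S \in (S : seq R) by rewrite -nth0 mem_nth// cardfs_gt0.
  by [].
rewrite /sqdist big_seq.
elim/big_ind: _; [by exists (head 0 S) | | by move=> a aS; exists a].
by move=> y z [a aS ->] [b bS ->]; rewrite minEle; case: ifP => _; [exists a | exists b].
Qed.

Lemma sqdist_ge0 (R : realType) (S : {fset R}) (x : R) : 0 <= sqdist S x.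
Proof.
rewrite /sqdist; elim/big_ind: _ => [|y z|a _]; rewrite ?sqr_ge0//.
by rewrite le_min => -> ->.
Qed.

Lemma measurable_sqdist (R : realType) (S : {fset R}) (A : set R) :
  measurable_fun (A : set (measurableTypeR R)) (sqdist S).
Proof.
apply: measurable_funTS; rewrite /sqdist.
have msq a : measurable_fun [set: measurableTypeR R] (fun x : R => (x - a) ^+ 2).
  by apply: measurable_funX; exact: measurable_funB.
suff gen (s : seq R) (b : R) : measurable_fun [set: measurableTypeR R]
    (fun x : R => \big[Num.min/(x - b) ^+ 2]_(a <- s) (x - a) ^+ 2) by exact: gen.
elim: s => [|c s IHs]; first by under eq_fun do rewrite big_nil; exact: msq.
under eq_fun do rewrite big_cons.
by apply: measurable_minr => //; exact: msq.
Qed.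

(** * Distortions as real numbers *)

(** Lebesgue measure stands in for [P1]: the weight 1/2 in [P] cancels the density 2. *)
Definition cost (R : realType) (S : {fset R}) : R :=
  fine (\int[lebesgue_measure]_(x in `[0%R, 2^-1%R]) (sqdist S x)%:E)%E.

Lemma integral_sqdistE (R : realType) (S : {fset R}) : S != fset0 ->
  (\int[lebesgue_measure]_(x in `[0%R, 2^-1%R]) (sqdist S x)%:E = (cost S)%:E)%E.
Proof.
move=> /fset0Pn[a aS]; rewrite /cost fineK// ge0_fin_numE; last first.
  by apply: integral_ge0 => x _; rewrite lee_fin sqdist_ge0.
(* A constant dominates: on [0, 1/2] the distance to one chosen [a] in [S] is at most [1 + |a|]. *)
apply: (@le_lt_trans _ _ (\int[lebesgue_measure]_(x in `[0%R, (2^-1)%R])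
   (cst ((1 + `|a|) ^+ 2)%:E x))%E).
  apply: ge0_le_integral => //.
  - by move=> x _; rewrite lee_fin sqdist_ge0.
  - by apply/measurable_EFinP; exact: measurable_sqdist.
  - move=> x /=; rewrite in_itv/= => /andP[x0 x1]; rewrite lee_fin.
    apply: (le_trans (sqdist_le x aS)).
    rewrite -[leLHS]real_normK ?num_real// lerXn2r ?nnegrE ?addr_ge0//.
    by rewrite (le_trans (ler_normB _ _))// lerD2r ger0_norm//; lra.
rewrite integral_cst//= lebesgue_measure_itv/= lte_fin invr_gt0 ltr0n.
by rewrite -EFinD -EFinM ltry.
Qed.

Lemma distortion_P1E (R : realType) (S : {fset R}) : S != fset0 ->
  distortion (P1 R) S = (2 * cost S)%:E.
Proof.
move=> S0; rewrite /distortion /P1.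
under eq_integral do rewrite bigmine_sqdist//.
rewrite integral_uniform; last 2 first.
- by apply/measurable_EFinP; exact: measurable_sqdist.
- by move=> x; rewrite lee_fin sqdist_ge0.
by rewrite integral_sqdistE// subr0 invrK EFinM.
Qed.

Lemma card_D (R : realType) : #|` D R| = 3%N.
Proof.
rewrite /D -fsetUA !cardfsU1 cardfs1 !inE.
have -> : (5 / 6 == 1 :> R) = false by apply/eqP; lra.
have -> : (2 / 3 == 5 / 6 :> R) = false by apply/eqP; lra.
by have -> : (2 / 3 == 1 :> R) = false by apply/eqP; lra.
Qed.

Lemma sum_D (R : realType) (f : R -> R) :
  \sum_(d <- D R) f d = f (2 / 3) + f (5 / 6) + f 1.
Proof.
have n1 : (2 / 3 : R) \notin [fset 5 / 6; 1]%fset.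
  by rewrite !inE negb_or; apply/andP; split; apply/eqP; lra.
have n2 : (5 / 6 : R) \notin [fset 1]%fset by rewrite !inE; apply/eqP; lra.
by rewrite /D -fsetUA (big_fsetU1 _ _ n1) (big_fsetU1 _ _ n2) big_seq_fset1 /= addrA.
Qed.

(** The divisor 6 comes from the mass 1/2 * 1/3 of each atom in [P]. *)
Definition mixed_cost (R : realType) (S : {fset R}) : R :=
  cost S + (sqdist S (2 / 3) + sqdist S (5 / 6) + sqdist S 1) / 6.

Lemma distortion_PE (R : realType) (S : {fset R}) : S != fset0 ->
  distortion (P R) S = (mixed_cost S)%:E.
Proof.
move=> S0; rewrite /distortion /P /mixture.
under eq_integral do rewrite bigmine_sqdist//.
have mf : measurable_fun [set: measurableTypeR R] (fun x => (sqdist S x)%:E).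
  by apply/measurable_EFinP; exact: measurable_sqdist.
have f0 (x : measurableTypeR R) : setT x -> (0 <= (sqdist S x)%:E)%E.
  by move=> _; rewrite lee_fin sqdist_ge0.
rewrite ge0_integral_measure_add//.
rewrite (ge0_integral_mscale (P1 R))// (ge0_integral_mscale (P2 R))//.
have -> : (\int[P1 R]_x (sqdist S x)%:E = (2 * cost S)%:E)%E.
  rewrite -(distortion_P1E S0) /distortion.
  by apply: eq_integral => x _; rewrite bigmine_sqdist.
have -> : (\int[P2 R]_x (sqdist S x)%:E =
  ((sqdist S (2 / 3) + sqdist S (5 / 6) + sqdist S 1) / 3)%:E)%E.
  rewrite /P2 /uniform_fset ge0_integral_mscale// ge0_integral_measure_sum//.
  under eq_bigr do rewrite integral_dirac// diracT mul1e.
  rewrite sumEFin -EFinM -(big_mkord xpredT (fun k => sqdist S (nth 0 (D R) k))).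
  rewrite -(big_nth 0 xpredT (sqdist S)) sum_D /= card_D.
  by rewrite mulrC.
by rewrite -!EFinM -EFinD /=; congr _%:E; rewrite /mixed_cost; field.
Qed.

(** * Caps (truncated parabolas) and their mass on [0, 1/2] *)

Definition cap (R : realType) (h a x : R) : R := Num.max 0 (h ^+ 2 - (x - a) ^+ 2).

Definition cap_mass (R : realType) (h a : R) : R :=
  let u := Num.max 0 (a - h) in let v := Num.min 2^-1 (a + h) in
  if u < v then h ^+ 2 * (v - u) - ((v - a) ^+ 3 - (u - a) ^+ 3) / 3 else 0.

Lemma cap_ge0 (R : realType) (h a x : R) : 0 <= cap h a x.
Proof. by rewrite /cap le_max lexx. Qed.

Lemma cap_ge (R : realType) (h a x : R) : h ^+ 2 - (x - a) ^+ 2 <= cap h a x.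
Proof. by rewrite /cap le_max lexx orbT. Qed.

Lemma cap_eq (R : realType) (h a x : R) : a - h <= x <= a + h ->
  cap h a x = h ^+ 2 - (x - a) ^+ 2.
Proof. by move=> /andP[? ?]; rewrite /cap max_r//; nra. Qed.

Lemma cap_eq0 (R : realType) (h a x : R) : 0 < h -> (x <= a - h) || (a + h <= x) ->
  cap h a x = 0.
Proof. by move=> h0 /orP[?|?]; rewrite /cap max_l//; nra. Qed.

Lemma measurable_cap (R : realType) (h a : R) (A : set R) :
  measurable_fun (A : set (measurableTypeR R)) (cap h a).
Proof.
apply: measurable_funTS; apply: measurable_maxr => //.
by apply: measurable_funB => //; apply: measurable_funX; exact: measurable_funB.
Qed.

Lemma integral_cap (R : realType) (h a : R) : 0 < h ->
  (\int[lebesgue_measure]_(x in `[0%R, 2^-1%R]) (cap h a x)%:E =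
   (cap_mass h a)%:E)%E.
Proof.
move=> h0; rewrite /cap_mass; set u := Num.max _ _; set v := Num.min _ _.
have Eu : (u = 0 /\ a - h <= 0) \/ (u = a - h /\ 0 <= a - h).
  by rewrite /u; case: (leP 0 (a - h)) => H; [right|left]; split=> //; exact: ltW.
have Ev : (v = 2^-1 /\ 2^-1 <= a + h) \/ (v = a + h /\ a + h <= 2^-1).
  by rewrite /v; case: (leP 2^-1 (a + h)) => H; [left|right]; split=> //; exact: ltW.
case: ltP => uv; last first.
  rewrite integral0_eq// => x /=; rewrite in_itv/= => /andP[x0 x1].
  by rewrite cap_eq0//; lra.
have sub : (`[u, v]%classic `<=` `[0%R, 2^-1%R])%classic.
  by move=> x /=; rewrite !in_itv/= => /andP[? ?]; apply/andP; split; lra.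
transitivity (\int[lebesgue_measure]_(x in `[u, v]) (cap h a x)%:E)%E.
  rewrite -[in RHS](setIidr sub) integral_mkcondr; apply: eq_integral => x.
  rewrite inE /= in_itv /= => /andP[x0 x1]; rewrite patchE; case: ifPn => //.
  rewrite notin_setE /= in_itv /= => /negP; rewrite negb_and -!ltNge => xuv.
  by rewrite cap_eq0//; apply/orP; case/orP: xuv => ?; [left|right]; lra.
transitivity (\int[lebesgue_measure]_(x in `[u, v]) (h ^+ 2 - (x - a) ^+ 2)%:E)%E.
  apply: eq_integral => x; rewrite inE/= in_itv/= => /andP[? ?].
  by rewrite cap_eq//; apply/andP; split; lra.
(* An antiderivative written as a polynomial, so that [horner] supplies the continuity and
   derivability for the fundamental theorem. *)
pose p : {poly R} := (h ^+ 2) *: 'X - 3^-1 *: ('X - a%:P) ^+ 3.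
have pE x : p.[x] = h ^+ 2 * x - (x - a) ^+ 3 / 3.
  by rewrite /p !hornerE/=; ring.
have dpE x : p^`().[x] = h ^+ 2 - (x - a) ^+ 2.
  by rewrite /p !poly.derivE !hornerE/=; field.
under eq_integral do rewrite -dpE.
rewrite (@continuous_FTC2 _ _ (horner p))//.
- by rewrite -EFinB !pE; congr _%:E; ring.
- by apply: continuous_subspaceT; exact: continuous_horner.
- split; first by move=> x _; exact: derivable_horner.
  + by apply: cvg_at_right_filter; exact: continuous_horner.
  + by apply: cvg_at_left_filter; exact: continuous_horner.
- by move=> x _; rewrite -derivE.
Qed.

(** The gap factors as [(h - y)^2 (2h + y) / 3]. The left side is the signed mass of a cap between
    its center and a cut at distance [y]. *)
Lemma cubic_leif (R : realType) (h y : R) : 0 < h -> - 2 * h < y ->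
  h ^+ 2 * y - y ^+ 3 / 3 <= 2 / 3 * h ^+ 3 ?= iff (y == h).
Proof.
move=> h0 y1; have E : 2 / 3 * h ^+ 3 - (h ^+ 2 * y - y ^+ 3 / 3) =
  (h - y) ^+ 2 * ((2 * h + y) / 3) by field.
split; first by rewrite -subr_ge0 E mulr_ge0 ?sqr_ge0//; lra.
rewrite eq_sym -subr_eq0 E mulf_eq0 sqrf_eq0 subr_eq0 (eq_sym h).
by rewrite [X in _ || X]gt_eqF ?orbF//; lra.
Qed.

(** A whole cap has mass [4/3 h^3]; [cubic_leif] bounds each side of [a] by half of it. *)
Lemma cap_mass_le (R : realType) (h a : R) : 0 < h ->
  cap_mass h a <= 4 / 3 * h ^+ 3.
Proof.
move=> h0; have h3 : 0 < h ^+ 3 by rewrite exprn_gt0.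
rewrite /cap_mass; set u := Num.max _ _; set v := Num.min _ _.
have Hu : a - h <= u by rewrite le_max lexx orbT.
have Hv : v <= a + h by rewrite ge_min lexx orbT.
case: ltP => uv; last by lra.
have H1 : - 2 * h < v - a by lra.
have H2 : - 2 * h < a - u by lra.
have [A1 _] := cubic_leif h0 H1; have [A2 _] := cubic_leif h0 H2.
have E3 : (a - u) ^+ 3 = - (u - a) ^+ 3 by ring.
lra.
Qed.

Lemma cap_mass_eq (R : realType) (h a : R) : 0 < h -> h <= a <= 2^-1 - h ->
  cap_mass h a = 4 / 3 * h ^+ 3.
Proof.
move=> h0 /andP[a0 a1]; rewrite /cap_mass max_r; last by lra.
rewrite min_r; last by lra.
by rewrite ifT; [field | lra].
Qed.

(** Equality must hold in [cubic_leif] on both sides of [a], so the cuts are at [a - h] and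
    [a + h]. *)
Lemma cap_mass_maximal (R : realType) (h a : R) : 0 < h ->
  4 / 3 * h ^+ 3 <= cap_mass h a -> h <= a <= 2^-1 - h.
Proof.
move=> h0; have h3 : 0 < h ^+ 3 by rewrite exprn_gt0.
rewrite /cap_mass; set u := Num.max _ _; set v := Num.min _ _.
have Hu : a - h <= u by rewrite le_max lexx orbT.
have Hv : v <= a + h by rewrite ge_min lexx orbT.
have Hu0 : 0 <= u by rewrite le_max lexx.
have Hv0 : v <= 2^-1 by rewrite ge_min lexx.
case: ltP => uv H; last by lra.
have H1 : - 2 * h < v - a by lra.
have H2 : - 2 * h < a - u by lra.
have [A1 B1] := cubic_leif h0 H1; have [A2 B2] := cubic_leif h0 H2.
have E3 : (a - u) ^+ 3 = - (u - a) ^+ 3 by ring.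
have /eqP E1 : v - a == h by rewrite -B1; apply/eqP; lra.
have /eqP E2 : a - u == h by rewrite -B2; apply/eqP; lra.
by apply/andP; split; lra.
Qed.

Lemma cap_mass_far (R : realType) (h a : R) : 2^-1 + h <= a -> cap_mass h a = 0.
Proof.
move=> a1; rewrite /cap_mass ifF//; apply/negbTE; rewrite -leNgt.
by rewrite ge_min !le_max; apply/orP; left; apply/orP; right; lra.
Qed.

(** The right side is what the atom [d], of mass 1/6, pays when [a] serves it. Beyond [1/2 + h]
    there is no gain; up to 1/2, [4/3 h^3 <= 1/384 < 1/216]; in between, only a tail of the cap lies
    in [0, 1/2]. *)
Lemma cap_mass_lt_sqr (R : realType) (h a d : R) : 0 < h <= 8^-1 -> 2 / 3 <= d ->
  a != d -> cap_mass h a < (d - a) ^+ 2 / 6.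
Proof.
move=> /andP[h0 h8] hd ad.
have d2 : 0 < (d - a) ^+ 2 / 6.
  by rewrite divr_gt0// exprn_even_gt0//= subr_eq0 eq_sym.
have [ha|ha] := leP (2^-1 + h) a; first by rewrite cap_mass_far.
have [a2|a2] := leP a 2^-1.
  have h2 : h ^+ 2 <= 8^-1 ^+ 2 by rewrite lerXn2r ?nnegrE//; lra.
  have h3 : h ^+ 3 <= 8^-1 ^+ 3 by rewrite lerXn2r ?nnegrE//; lra.
  apply: (le_lt_trans (cap_mass_le _ h0)).
  have : 6^-1 ^+ 2 <= (d - a) ^+ 2 by rewrite lerXn2r ?nnegrE//; lra.
  lra.
rewrite /cap_mass max_r; last by lra.
rewrite min_l; last by lra.
rewrite ifT; last by lra.
(* The tail has base [h - w], which is less than [d - a] because [h <= 1/8 < d - 1/2]. *)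
set w := a - 2^-1.
have -> : h ^+ 2 * (2^-1 - (a - h)) - ((2^-1 - a) ^+ 3 - (a - h - a) ^+ 3) / 3 =
   (h - w) ^+ 2 * (2 * h + w) / 3 by rewrite /w; field.
have w0 : 0 < w < h by rewrite /w; apply/andP; split; lra.
have s0 : (h - w) ^+ 2 < (d - a) ^+ 2.
  by rewrite ltrXn2r ?nnegrE//=; rewrite /w in w0 *; lra.
(* As [2h + w < 3h <= 3/8], the tail has mass at most [(h - w)^2 / 8]. *)
have : (h - w) ^+ 2 * (2 * h + w) <= (h - w) ^+ 2 * (3 / 8).
  by rewrite ler_wpM2l ?sqr_ge0//; clear -w0 h8; lra.
have := sqr_ge0 (h - w); lra.
Qed.

Lemma cap_mass_le_sqr (R : realType) (h a d : R) : 0 < h <= 8^-1 -> 2 / 3 <= d ->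
  cap_mass h a <= (d - a) ^+ 2 / 6 ?= iff (a == d).
Proof.
move=> hh hd; apply/leifP; case: eqVneq => [->|]; last exact: cap_mass_lt_sqr.
by rewrite cap_mass_far ?subrr ?expr0n ?mul0r//; lra.
Qed.

(** * Integrated inequalities between cost and cap masses *)

Lemma integral_sqdist_cap (R : realType) (S : {fset R}) (h : R) :
  S != fset0 -> 0 < h ->
  (\int[lebesgue_measure]_(x in `[0%R, 2^-1%R])
     (sqdist S x + \sum_(a <- S) cap h a x)%:E =
   (cost S + \sum_(a <- S) cap_mass h a)%:E)%E.
Proof.
move=> S0 h0; under eq_integral do rewrite EFinD -sumEFin.
have mb a : measurable_fun (`[0%R, 2^-1%R]%classic : set (measurableTypeR R))
    (fun x => (cap h a x)%:E) by apply/measurable_EFinP; exact: measurable_cap.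
rewrite ge0_integralD//.
- rewrite integral_sqdistE// ge0_integral_sum//.
    by under eq_bigr do rewrite integral_cap//; rewrite sumEFin -EFinD.
  by move=> a x _; rewrite lee_fin cap_ge0.
- by move=> x _; rewrite lee_fin sqdist_ge0.
- by apply/measurable_EFinP; exact: measurable_sqdist.
- by move=> x _; apply: sume_ge0 => a _; rewrite lee_fin cap_ge0.
- exact: emeasurable_sum.
Qed.

Lemma cost_le (R : realType) (S : {fset R}) (h : R) : S != fset0 -> 0 < h ->
  (forall x, 0 <= x <= 2^-1 -> sqdist S x + \sum_(a <- S) cap h a x <= h ^+ 2) ->
  cost S + \sum_(a <- S) cap_mass h a <= h ^+ 2 / 2.
Proof.
move=> S0 h0 H; rewrite -lee_fin -integral_sqdist_cap//.
have -> : ((h ^+ 2 / 2)%:E =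
    \int[lebesgue_measure]_(x in `[0%R, 2^-1%R]) cst (h ^+ 2)%:E x)%E.
  rewrite integral_cst//= lebesgue_measure_itv/= lte_fin invr_gt0 ltr0n.
  by rewrite -EFinD -EFinM subr0.
have mb : measurable_fun (`[0%R, 2^-1%R]%classic : set (measurableTypeR R))
    (fun x => sqdist S x + \sum_(a <- S) cap h a x).
  by apply: measurable_funD; [exact: measurable_sqdist|
     apply: measurable_sum => a; exact: measurable_cap].
apply: ge0_le_integral => //.
- by move=> x _; rewrite lee_fin addr_ge0 ?sqdist_ge0// sumr_ge0// => a _; exact: cap_ge0.
- exact/measurable_EFinP.
Qed.

(** An excess [c] on a subinterval survives integration: [c = 0] gives the plain bound, [c > 0] the
    strict one for overlapping caps. *)
Lemma cost_ge_gap (R : realType) (S : {fset R}) (h c u v : R) :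
  S != fset0 -> 0 < h -> 0 <= c -> 0 <= u < v -> v <= 2^-1 ->
  (forall x, 0 <= x <= 2^-1 -> h ^+ 2 <= sqdist S x + \sum_(a <- S) cap h a x) ->
  (forall x, u <= x <= v -> h ^+ 2 + c <= sqdist S x + \sum_(a <- S) cap h a x) ->
  h ^+ 2 / 2 + c * (v - u) <= cost S + \sum_(a <- S) cap_mass h a.
Proof.
move=> S0 h0 c0 /andP[u0 uv] v1 H1 H2; rewrite -lee_fin -integral_sqdist_cap//.
have mi : measurable (`[u, v]%classic : set (measurableTypeR R)) by [].
have mI : measurable (`[0%R, 2^-1%R]%classic : set (measurableTypeR R)) by [].
have m1 : measurable_fun (`[0%R, 2^-1%R]%classic : set (measurableTypeR R))
    (fun x => (\1_(`[u, v]%classic) x)%:E : \bar R).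
  by apply/measurable_EFinP; exact: measurable_indic.
have -> : ((h ^+ 2 / 2 + c * (v - u))%:E =
    \int[lebesgue_measure]_(x in `[0%R, 2^-1%R])
       ((h ^+ 2)%:E + c%:E * (\1_(`[u, v]%classic) x)%:E))%E.
  rewrite ge0_integralD//; last 3 first.
  - by move=> x _; rewrite lee_fin sqr_ge0.
  - by move=> x _; rewrite lee_fin mulr_ge0.
  - by apply/measurable_EFinP; apply: measurable_funM => //; exact: measurable_indic.
  rewrite integral_cst//= (ge0_integralZl _ _ m1)//.
  rewrite integral_indic// setIidl; last first.
    by move=> x /=; rewrite !in_itv/= => /andP[? ?]; apply/andP; split; lra.
  have Euv : lebesgue_measure (`[u, v]%classic : set R) = (v - u)%:E.
    by rewrite lebesgue_measure_itv/= lte_fin uv -EFinB.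
  have EI : lebesgue_measure (`[0%R, 2^-1%R]%classic : set R) = (2^-1)%:E.
    by rewrite lebesgue_measure_itv/= lte_fin invr_gt0 ltr0n -EFinB subr0.
  rewrite -[X in (_ + _ * X)%E]/(lebesgue_measure (`[u, v]%classic : set R)).
  by rewrite Euv EI -!EFinM -EFinD.
have mb : measurable_fun (`[0%R, 2^-1%R]%classic : set (measurableTypeR R))
    (fun x => sqdist S x + \sum_(a <- S) cap h a x).
  by apply: measurable_funD; [exact: measurable_sqdist|
     apply: measurable_sum => a; exact: measurable_cap].
apply: ge0_le_integral => //.
- by move=> x _; rewrite -EFinM -EFinD lee_fin addr_ge0 ?sqr_ge0// mulr_ge0.
- by apply: emeasurable_funD => //; exact: emeasurable_funM.
- exact/measurable_EFinP.
- move=> x /= Ix; rewrite -EFinM -EFinD lee_fin indicE.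
  case: (boolP (x \in _)) => xuv; last first.
    by rewrite mulr0 addr0; apply: H1; rewrite in_itv/= in Ix.
  by rewrite mulr1; apply: H2; move: xuv; rewrite inE/= in_itv.
Qed.

Lemma sum_ge_mem (R : realType) (S : {fset R}) (f : R -> R) (a : R) :
  (forall x, 0 <= f x) -> a \in S -> f a <= \sum_(x <- S) f x.
Proof.
by move=> f0 aS; rewrite (big_fsetD1 a)//= lerDl sumr_ge0.
Qed.

(** The cap of a nearest point already suffices; the others are nonnegative. *)
Lemma sqdist_cap_ge (R : realType) (S : {fset R}) (h x : R) : S != fset0 ->
  h ^+ 2 <= sqdist S x + \sum_(a <- S) cap h a x.
Proof.
move=> S0; have [b bS ->] := sqdist_attained x S0.
have := @sum_ge_mem R S (fun a => cap h a x) b (fun a => cap_ge0 h a x) bS.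
by have := cap_ge h b x; lra.
Qed.

(** One of [a], [b] differs from the nearest point chosen at [x]; its cap adds at least
    [h^2 - g]. *)
Lemma sqdist_cap_ge2 (R : realType) (S : {fset R}) (h g a b x : R) : S != fset0 ->
  a \in S -> b \in S -> a != b ->
  (x - a) ^+ 2 <= g -> (x - b) ^+ 2 <= g ->
  h ^+ 2 + (h ^+ 2 - g) <= sqdist S x + \sum_(a <- S) cap h a x.
Proof.
move=> S0 aS bS ab ga gb; have [c cS ->] := sqdist_attained x S0.
have [d [dS dc dg]] : exists d, [/\ d \in S, d != c & (x - d) ^+ 2 <= g].
  by have [ac|ac] := eqVneq a c; [exists b; rewrite -ac eq_sym|exists a].
rewrite (big_fsetD1 c)//=.
have dSc : d \in (S `\ c)%fset by rewrite !inE dc.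
have := @sum_ge_mem R _ (fun a => cap h a x) d (fun a => cap_ge0 h a x) dSc.
by have := cap_ge h c x; have := cap_ge h d x; lra.
Qed.

Lemma cost_ge (R : realType) (S : {fset R}) (h : R) : S != fset0 -> 0 < h ->
  h ^+ 2 / 2 <= cost S + \sum_(a <- S) cap_mass h a.
Proof.
move=> S0 h0.
have H x := @sqdist_cap_ge R S h x S0.
have H0 x : h ^+ 2 + 0 <= sqdist S x + \sum_(a <- S) cap h a x by rewrite addr0.
have I0 : 0 <= (0 : R) < (2 : R)^-1 by apply/andP; split; lra.
have := @cost_ge_gap R S h 0 0 2^-1 S0 h0 (lexx 0) I0 (lexx _)
  (fun x _ => H x) (fun x _ => H0 x).
by rewrite mul0r addr0.
Qed.

(** Two points closer than [2h] have caps that overlap around their midpoint, and this excess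
    contradicts the assumed upper bound. *)
Lemma cost_eq_separated (R : realType) (S : {fset R}) (h a b : R) :
  0 < h -> cost S + \sum_(a <- S) cap_mass h a <= h ^+ 2 / 2 ->
  a \in S -> b \in S -> h <= a -> b <= 2^-1 - h -> a < b -> 2 * h <= b - a.
Proof.
move=> h0 Hc aS bS ha hb ab; rewrite leNgt; apply/negP => close.
have S0 : S != fset0 by apply/fset0Pn; exists a.
(* [e] is a quarter of the overlap: within [e] of the midpoint [p], both points are at distance at
   most [h - e]. *)
pose e := (2 * h - (b - a)) / 4; pose p := (a + b) / 2.
have e0 : 0 < e by rewrite /e; lra.
have he : 0 < h - e by rewrite /e; lra.
suff : h ^+ 2 / 2 + (h ^+ 2 - (h - e) ^+ 2) * (p + e - (p - e)) <=
    cost S + \sum_(a <- S) cap_mass h a.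
  have : 0 < (h ^+ 2 - (h - e) ^+ 2) * (p + e - (p - e)).
    by apply: mulr_gt0; [nra|lra].
  lra.
apply: cost_ge_gap => //; rewrite ?/p; first by nra.
- by apply/andP; split; rewrite /e; lra.
- by rewrite /e; lra.
- by move=> x _; exact: sqdist_cap_ge.
- move=> x /andP[x1 x2]; apply: (@sqdist_cap_ge2 R S h _ a b x S0 aS bS).
  + by rewrite lt_eqF.
  + by rewrite -[leLHS]real_normK ?num_real// lerXn2r ?nnegrE// ?(ltW he)// ler_norml;
      rewrite /e in x1 x2 *; lra.
  + by rewrite -[leLHS]real_normK ?num_real// lerXn2r ?nnegrE// ?(ltW he)// ler_norml;
      rewrite /e in x1 x2 *; lra.
Qed.

(** * Equally spaced centers *)

(** Midpoints of the [m] equal cells of [0, 1/2]; indices start at 0, hence [2i + 1]. *)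
Definition centers (R : realType) (m : nat) : {fset R} :=
  [fset (2 * (nat_of_ord i)%:R + 1) / (4 * m%:R) | i : 'I_m]%fset.

Lemma card_centers (R : realType) (m : nat) : #|` centers R m| = m.
Proof.
rewrite card_in_imfset/= ?card_ord -?cardE ?card_ord// => i j _ _ /=.
have m0 : (m%:R : R) != 0 by rewrite pnatr_eq0 -lt0n (leq_ltn_trans _ (ltn_ord i)).
move=> E; apply/val_inj/eqP; rewrite -(eqr_nat R); apply/eqP => /=.
have m4 : (4 * m%:R : R) != 0 by rewrite mulf_neq0//; apply/eqP; lra.
have : (2 * i%:R + 1) / (4 * m%:R) * (4 * m%:R) =
    (2 * j%:R + 1) / (4 * m%:R) * (4 * m%:R) :> R by rewrite E.
by rewrite !divfK//; lra.
Qed.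

Lemma cell_index (R : realType) (m : nat) (x l : R) : (0 < m)%N -> 0 <= x <= m%:R * l ->
  exists2 i, (i < m)%N & i%:R * l <= x <= (i%:R + 1) * l.
Proof.
elim: m => [//|m IHm] _ /andP[x0 x1].
have [|xm] := leP x (m%:R * l); last first.
  by exists m => //; apply/andP; split; [exact: ltW|move: x1; rewrite -natr1].
case: m IHm x1 => [|m] IHm x1 xm.
  by exists 0%N => //; apply/andP; split; lra.
have [|i im Hi] := IHm isT; first by rewrite x0.
by exists i => //; exact: ltnW.
Qed.

Lemma centersP (R : realType) (m : nat) (a h : R) : (0 < m)%N -> h = (4 * m%:R)^-1 ->
  reflect (exists2 i, (i < m)%N & a = (2 * i%:R + 1) * h) (a \in centers R m).
Proof.
move=> m0 ->; apply: (iffP (imfsetP _ _ _ _)) => /=.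
  by move=> [i _ ->]; exists i.
move=> [i im ->].
by exists (Ordinal im).
Qed.

(** The supports of the caps are the cells, so at each [x] only the cap of its own cell counts and
    [cost_le] applies. *)
Lemma cost_centers (R : realType) (m : nat) (h : R) : (0 < m)%N -> h = (4 * m%:R)^-1 ->
  cost (centers R m) + m%:R * (4 / 3 * h ^+ 3) <= h ^+ 2 / 2.
Proof.
move=> m0 hE; have N0 : 0 < m%:R :> R by rewrite ltr0n.
have h0 : 0 < h by rewrite hE invr_gt0 mulr_gt0.
have Nh : m%:R * (4 * h) = 1 by rewrite hE; field; rewrite gt_eqF.
have S0 : centers R m != fset0 by rewrite -cardfs_gt0 card_centers.
have -> : m%:R * (4 / 3 * h ^+ 3) = \sum_(a <- centers R m) cap_mass h a.
  rewrite (eq_big_seq (fun=> 4 / 3 * h ^+ 3)).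
    rewrite big_const_seq count_predT iter_addr_0.
    by rewrite -[size _]/(#|` centers R m|) card_centers mulr_natl.
  move=> a /(centersP _ m0 hE)[i im ->]; apply: cap_mass_eq => //.
  have i0 : 0 <= i%:R * h by rewrite mulr_ge0// ltW.
  have : (i%:R + 1) * h <= m%:R * h by rewrite ler_wpM2r ?(ltW h0)// natr1 ler_nat.
  by move=> ?; apply/andP; split; lra.
apply: cost_le => // x /andP[x0 x1].
have [|i im /andP[i1 i2]] := @cell_index R m x (2 * h) m0.
  by rewrite x0 /=; lra.
pose a := (2 * i%:R + 1) * h.
have aC : a \in centers R m by apply/(centersP _ m0 hE); exists i.
apply: (le_trans (lerD (sqdist_le x aC) (lexx _))).
have xa : a - h <= x <= a + h by rewrite /a; apply/andP; split; lra.
rewrite (big_fsetD1 a)//= cap_eq// big_seq big1 ?addr0; first by rewrite addrC subrK.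
move=> b; rewrite !inE => /andP[ba /(centersP _ m0 hE)[j jm bE]].
apply: cap_eq0 => //; move/andP: xa => [xa1 xa2].
(* Another center is at least [2h] from [a], so its cap vanishes at [x], even at a shared end of two
   cells. *)
have [ij|ij|ij] := ltngtP i j; last by rewrite bE -ij eqxx in ba.
  apply/orP; left; have : (i%:R + 1) * h <= j%:R * h.
    by rewrite ler_wpM2r ?(ltW h0)// natr1 ler_nat.
  by rewrite /a in xa2; lra.
apply/orP; right; have : (j%:R + 1) * h <= i%:R * h.
  by rewrite ler_wpM2r ?(ltW h0)// natr1 ler_nat.
by rewrite /a in xa1; lra.
Qed.

(** [m] intervals of length [2h] leave no slack in [0, 1/2]: packing from the left and packing from
    the right give the same bound on each sorted point. *)
Lemma separated_eq_centers (R : realType) (m : nat) (h : R) (T : {fset R}) :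
  (0 < m)%N -> h = (4 * m%:R)^-1 -> #|` T| = m ->
  (forall a, a \in T -> h <= a <= 2^-1 - h) ->
  (forall a b, a \in T -> b \in T -> a < b -> 2 * h <= b - a) ->
  T = centers R m.
Proof.
move=> m0 hE cT inT sepT; have N0 : 0 < m%:R :> R by rewrite ltr0n.
have h0 : 0 < h by rewrite hE invr_gt0 mulr_gt0.
have Nh : m%:R * (4 * h) = 1 by rewrite hE; field; rewrite gt_eqF.
pose s := sort <=%O (T : seq R).
have ss : size s = m by rewrite size_sort.
have sT i : (i < m)%N -> nth 0 s i \in T.
  by move=> im; have : nth 0 s i \in s; [rewrite mem_nth ?ss|rewrite mem_sort].
have su : sorted <%O s by rewrite sort_lt_sorted; exact: fset_uniq.
have slt i j : (i < j)%N -> (j < m)%N -> nth 0 s i < nth 0 s j.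
  move=> ij jm; apply: (sorted_ltn_nth lt_trans) => //; rewrite inE ss//.
  exact: ltn_trans jm.
have step i : (i.+1 < m)%N -> nth 0 s i + 2 * h <= nth 0 s i.+1.
  move=> im; have := sepT _ _ (sT i (ltnW im)) (sT _ im) (slt _ _ (ltnSn i) im); lra.
have lo i : (i < m)%N -> (2 * i%:R + 1) * h <= nth 0 s i.
  elim: i => [_|i IHi im].
    by have /andP[] := inT _ (sT 0%N m0); lra.
  by have := IHi (ltnW im); have := step _ im; rewrite -natr1; lra.
have subm k : (m - k.+1 < m)%N by rewrite ltn_subrL m0.
(* [k] counts from the right end, starting at 0. *)
have hi k : (k < m)%N -> nth 0 s (m - k.+1) <= 2^-1 - (2 * k%:R + 1) * h.
  elim: k => [_|k IHk km].
    by have /andP[] := inT _ (sT (m - 1)%N (subm 0%N)); lra.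
  have E : (m - k.+1 = (m - k.+2).+1)%N by rewrite -subSn.
  have := step (m - k.+2)%N; rewrite -E => /(_ (subm k)).
  by have := IHk (ltnW km); rewrite -natr1; lra.
apply/eqP; rewrite eqEfcard card_centers cT leqnn andbT; apply/fsubsetP => a aT.
have ais : a \in s by rewrite mem_sort.
have im : (index a s < m)%N by rewrite -ss index_mem.
apply/(centersP _ m0 hE); exists (index a s) => //.
rewrite -[LHS](nth_index 0 ais); apply/le_anti/andP; split; last exact: lo.
(* As [2mh = 1/2], the bound from the right at this index is the value in [lo]. *)
have := hi _ (subm (index a s)); rewrite subnSK ?leq_subr// subKn; last exact: ltnW.
by rewrite natrB// -[(index a s).+1%:R]natr1; lra.
Qed.

(** * Bounds by the number of points, and the equality case *)

Lemma sum_cap_mass_le (R : realType) (T : {fset R}) (h : R) (m : nat) : 0 < h ->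
  (#|` T| <= m)%N -> \sum_(a <- T) cap_mass h a <= m%:R * (4 / 3 * h ^+ 3).
Proof.
move=> h0 Tm; apply: (@le_trans _ _ (\sum_(a <- T) 4 / 3 * h ^+ 3)).
  by apply: ler_sum => a _; exact: cap_mass_le.
rewrite big_const_seq count_predT iter_addr_0 -[size _]/(#|` T|) -[leLHS]mulr_natl.
by rewrite ler_wpM2r ?ler_nat// mulr_ge0// exprn_ge0 ?ltW.
Qed.

(** [T] is meant as the part of [S] whose caps count on [0, 1/2]. Here [m] full caps have mass
    [h^2/3], and [h^2/2 - h^2/3 = h^2/6]. *)
Lemma cost_ge_card (R : realType) (S T : {fset R}) (m : nat) (h : R) :
  S != fset0 -> (0 < m)%N -> h = (4 * m%:R)^-1 -> (#|` T| <= m)%N ->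
  \sum_(a <- S) cap_mass h a = \sum_(a <- T) cap_mass h a ->
  h ^+ 2 / 6 <= cost S.
Proof.
move=> S0 m0 hE Tm ST; have N0 : 0 < m%:R :> R by rewrite ltr0n.
have h0 : 0 < h by rewrite hE invr_gt0 mulr_gt0.
have Nh : m%:R * (4 / 3 * h ^+ 3) = h ^+ 2 / 3 by rewrite hE; field; rewrite gt_eqF.
have := cost_ge S0 h0; have := sum_cap_mass_le h0 Tm; rewrite ST Nh; lra.
Qed.

(** The mass bound forces [m] points with full caps, hence inside [0, 1/2]; the cost bound separates
    them by [2h], which leaves only the centers. *)
Lemma rigid_centers (R : realType) (S T : {fset R}) (m : nat) (h : R) :
  (0 < m)%N -> h = (4 * m%:R)^-1 -> {subset T <= S} -> (#|` T| <= m)%N ->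
  cost S + \sum_(a <- S) cap_mass h a <= h ^+ 2 / 2 ->
  m%:R * (4 / 3 * h ^+ 3) <= \sum_(a <- T) cap_mass h a ->
  T = centers R m.
Proof.
move=> m0 hE TS Tm cS sT; have N0 : 0 < m%:R :> R by rewrite ltr0n.
have h0 : 0 < h by rewrite hE invr_gt0 mulr_gt0.
have l0 : 0 < 4 / 3 * h ^+ 3 by rewrite mulr_gt0// exprn_gt0.
have cT : #|` T| = m.
  apply/eqP; rewrite eqn_leq Tm /= leqNgt; apply/negP => Tlt.
  have := sum_cap_mass_le h0 (leqnn #|` T|).
  have : (#|` T|%:R : R) * (4 / 3 * h ^+ 3) < m%:R * (4 / 3 * h ^+ 3).
    by rewrite ltr_pM2r// ltr_nat.
  lra.
have inT a : a \in T -> h <= a <= 2^-1 - h.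
  move=> aT; apply: cap_mass_maximal => //.
  (* The other [m - 1] points carry at most [m - 1] full caps, so the cap of [a] is full. *)
  move: sT; rewrite (big_fsetD1 a)//=.
  have m1 : (#|` (T `\ a)%fset| <= m.-1)%N by rewrite -cT (cardfsD1 a T) aT.
  have := sum_cap_mass_le h0 m1.
  have Em : m%:R = m.-1%:R + 1 :> R by rewrite natr1 prednK.
  by rewrite Em; lra.
apply: (separated_eq_centers m0 hE cT inT) => a b aT bT ab.
have /andP[ha _] := inT _ aT; have /andP[_ hb] := inT _ bT.
exact: (cost_eq_separated h0 cS (TS _ aT) (TS _ bT)).
Qed.

(** * The mixture: lower bound and equality case *)

Lemma cost_ge0 (R : realType) (S : {fset R}) : 0 <= cost S.
Proof.
rewrite /cost fine_ge0//; apply: integral_ge0 => x _.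
by rewrite lee_fin sqdist_ge0.
Qed.

Lemma cost_subset (R : realType) (S T : {fset R}) : S != fset0 ->
  (S `<=` T)%fset -> cost T <= cost S.
Proof.
move=> S0 ST; have T0 : T != fset0 by apply: contraNneq S0 => T0; rewrite -fsubset0 -T0.
rewrite -lee_fin -!integral_sqdistE//; apply: ge0_le_integral => //.
- by move=> x _; rewrite lee_fin sqdist_ge0.
- by apply/measurable_EFinP; exact: measurable_sqdist.
- by apply/measurable_EFinP; exact: measurable_sqdist.
- move=> x _; rewrite lee_fin; have [a aS ->] := sqdist_attained x S0.
  by apply: sqdist_le; exact: (fsubsetP ST).
Qed.

(** Rules out one point serving two atoms: either [a] is far from [d'], or it gains nothing on
    [0, 1/2]. *)
Lemma shared_center_lt (R : realType) (S : {fset R}) (m : nat) (h a d d' : R) :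
  (1 < m)%N -> h = (4 * m%:R)^-1 -> (#|` S| <= m + 3)%N -> a \in S ->
  2 / 3 <= d -> d + 1 / 6 <= d' ->
  h ^+ 2 / 6 < cost S + ((d - a) ^+ 2 + (d' - a) ^+ 2) / 6.
Proof.
move=> m1 hE Sm aS hd hd'; have m2 : 2 <= m%:R :> R by rewrite ler_nat.
have S0 : S != fset0 by apply/fset0Pn; exists a.
have h0 : 0 < h by rewrite hE invr_gt0; lra.
have Nh : m%:R * (4 * h) = 1 by rewrite hE; field; lra.
have h8 : h <= 8^-1 by nra.
have hh : h ^+ 2 <= 8^-1 ^+ 2 by rewrite lerXn2r ?nnegrE//; lra.
(* 5/8 is 1/2 + 1/8. Below it, [d'] alone costs at least [(5/24)^2 / 6], more than
   [h^2/6 <= 1/384]. *)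
have [a58|a58] := ltP a (5 / 8).
  have : (5 / 24) ^+ 2 <= (d' - a) ^+ 2 by rewrite lerXn2r ?nnegrE//; lra.
  by have := cost_ge0 S; have := sqr_ge0 (d - a); lra.
(* Otherwise at most [m + 2] points serve [0, 1/2], whence the radius [k]; [m + 2 <= 2m] gives
   [k >= h/2]. *)
pose k : R := (4 * (m + 2)%:R)^-1.
have kE : k = (4 * (m%:R + 2))^-1 by rewrite /k natrD.
have k0 : 0 < k by rewrite kE invr_gt0; lra.
have kh : h / 2 <= k by rewrite kE hE -invfM lef_pV2 ?posrE; lra.
have k8 : k <= 8^-1 by rewrite kE lef_pV2 ?posrE; lra.
have ck : k ^+ 2 / 6 <= cost S.
  apply: (@cost_ge_card R S (S `\ a)%fset (m + 2) k) => //.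
  - by rewrite addn_gt0 orbT.
  - by move: Sm; rewrite (cardfsD1 a S) aS addnC !addnS addn0 ltnS.
  - by rewrite (big_fsetD1 a)//= cap_mass_far ?add0r//; lra.
have kk : (h / 2) ^+ 2 <= k ^+ 2 by rewrite lerXn2r ?nnegrE//; lra.
(* The two squares sum to at least half of [(d' - d)^2]. This costs 1/432, against a saving
   [h^2/6 - k^2/6 <= h^2/8 <= 1/512]. *)
have : 1 / 72 <= (d - a) ^+ 2 + (d' - a) ^+ 2.
  have : (1 / 6) ^+ 2 <= (d' - d) ^+ 2 by rewrite lerXn2r ?nnegrE//; lra.
  by have := sqr_ge0 (d + d' - 2 * a); lra.
lra.
Qed.

Lemma mixed_cost_ge (R : realType) (S : {fset R}) (m : nat) (h : R) :
  S != fset0 -> (1 < m)%N -> h = (4 * m%:R)^-1 -> (#|` S| <= m + 3)%N ->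
  h ^+ 2 / 6 <= mixed_cost S /\
  (mixed_cost S <= h ^+ 2 / 6 -> S = (centers R m `|` D R)%fset).
Proof.
move=> S0 m1 hE Sm; rewrite /mixed_cost.
have m2 : 2 <= m%:R :> R by rewrite ler_nat.
have h0 : 0 < h by rewrite hE invr_gt0; lra.
have Nh : m%:R * (4 * h) = 1 by rewrite hE; field; lra.
have Nl : m%:R * (4 / 3 * h ^+ 3) = h ^+ 2 / 3 by rewrite hE; field; lra.
have h8 : 0 < h <= 8^-1 by rewrite h0 /=; nra.
have [a aS aE] := sqdist_attained (2 / 3) S0.
have [b bS bE] := sqdist_attained (5 / 6) S0.
have [c cS cE] := sqdist_attained 1 S0.
have sq0 d := sqdist_ge0 S d.
(* A shared nearest point gives a strict inequality, which settles both claims at once. *)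
have strict x : h ^+ 2 / 6 < x -> h ^+ 2 / 6 <= x /\
    (x <= h ^+ 2 / 6 -> S = (centers R m `|` D R)%fset) 
  by move=> hx; split=> [|xh]; [exact: ltW|have := lt_le_trans hx xh; rewrite ltxx].
have [ab|ab] := eqVneq a b.
  apply: strict; have := @shared_center_lt R S m h a (2 / 3) (5 / 6) m1 hE Sm aS.
  by rewrite aE bE -ab; have := sq0 1; lra.
have [ac|ac] := eqVneq a c.
  apply: strict; have := @shared_center_lt R S m h a (2 / 3) 1 m1 hE Sm aS.
  by rewrite aE cE -ac; have := sq0 (5 / 6); lra.
have [bc|bc] := eqVneq b c.
  apply: strict; have := @shared_center_lt R S m h b (5 / 6) 1 m1 hE Sm bS.
  by rewrite bE cE -bc; have := sq0 (2 / 3); lra.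
rewrite aE bE cE.
have bC : b \in (S `\ c)%fset by rewrite !inE bc.
pose T := (S `\ c `\ b `\ a)%fset.
have aC : a \in (S `\ c `\ b)%fset by rewrite !inE ab ac.
have SE : S = (c |` (b |` (a |` T)))%fset by rewrite /T !fsetD1K.
have Tm : (#|` T| <= m)%N.
  move: Sm; rewrite (cardfsD1 c S) cS (cardfsD1 b (S `\ c)%fset) bC.
  by rewrite (cardfsD1 a (S `\ c `\ b)%fset) aC /= !add1n !addnS addn0 !ltnS.
have sumS : \sum_(x <- S) cap_mass h x = cap_mass h c + (cap_mass h b +
    (cap_mass h a + \sum_(x <- T) cap_mass h x)).
  by rewrite (big_fsetD1 c)//= (big_fsetD1 b)//= (big_fsetD1 a).
have TS : {subset T <= S} by move=> x; rewrite !inE => /and4P[].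
have lT := sum_cap_mass_le h0 Tm.
have lS := cost_ge S0 h0.
have d1 : (2 : R) / 3 <= 2 / 3 by [].
have d2 : (2 : R) / 3 <= 5 / 6 by lra.
have d3 : (2 : R) / 3 <= 1 by lra.
have [la ea] := cap_mass_le_sqr a h8 d1.
have [lb eb] := cap_mass_le_sqr b h8 d2.
have [lc ec] := cap_mass_le_sqr c h8 d3.
(* The atom terms pay for the caps of [a], [b], [c], and [T] takes at most [h^2/3] from [h^2/2]. If
   the total is [h^2/6], each of these estimates is tight. *)
rewrite sumS Nl in lS lT; split=> [|le6]; first by lra.
have /eqP a1 : a == 2 / 3 by rewrite -ea; apply/eqP; lra.
have /eqP b1 : b == 5 / 6 by rewrite -eb; apply/eqP; lra.
have /eqP c1 : c == 1 by rewrite -ec; apply/eqP; lra.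
have TE : T = centers R m.
  apply: (rigid_centers (ltnW m1) hE TS Tm); first by rewrite sumS; lra.
  by rewrite Nl; lra.
rewrite SE TE a1 b1 c1; apply/fsetP => x; rewrite !inE.
by case: (x \in _); case: (x == 2 / 3); case: (x == 5 / 6); case: (x == 1).
Qed.

(** Points at the atoms cancel the atom terms, and enlarging a set never raises [cost]. *)
Lemma mixed_cost_centers (R : realType) (m : nat) (h : R) :
  (0 < m)%N -> h = (4 * m%:R)^-1 ->
  mixed_cost (centers R m `|` D R)%fset <= h ^+ 2 / 6.
Proof.
move=> m0 hE; have N0 : 0 < m%:R :> R by rewrite ltr0n.
have h0 : 0 < h by rewrite hE invr_gt0 mulr_gt0.
have Nl : m%:R * (4 / 3 * h ^+ 3) = h ^+ 2 / 3 by rewrite hE; field; rewrite gt_eqF.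
have sq0 d : d \in D R -> sqdist (centers R m `|` D R)%fset d = 0.
  move=> dD; apply/le_anti; rewrite sqdist_ge0 andbT.
  apply: le_trans (sqdist_le d (_ : d \in _)) _; first by rewrite inE dD orbT.
  by rewrite subrr expr0n.
rewrite /mixed_cost !sq0 ?inE ?eqxx ?orbT// !addr0 mul0r addr0.
have C0 : centers R m != fset0 by rewrite -cardfs_gt0 card_centers.
have := cost_centers m0 hE; rewrite Nl.
suff : cost (centers R m `|` D R)%fset <= cost (centers R m) by lra.
by apply: cost_subset => //; exact: fsubsetUl.
Qed.

(** * Optimal sets and quantization errors *)

(** Uniqueness for [P1], required since the theorem takes [beta] as any optimal set. *)
Lemma cost_uniform_rigid (R : realType) (S : {fset R}) (m : nat) (h : R) :
  S != fset0 -> (0 < m)%N -> h = (4 * m%:R)^-1 -> (#|` S| <= m)%N ->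
  cost S <= h ^+ 2 / 6 -> S = centers R m.
Proof.
move=> S0 m0 hE Sm cS; have N0 : 0 < m%:R :> R by rewrite ltr0n.
have h0 : 0 < h by rewrite hE invr_gt0 mulr_gt0.
have Nl : m%:R * (4 / 3 * h ^+ 3) = h ^+ 2 / 3 by rewrite hE; field; rewrite gt_eqF.
have := cost_ge S0 h0; have := sum_cap_mass_le h0 Sm; rewrite Nl => le1 le2.
by apply: (rigid_centers m0 hE (fun _ => id) Sm); rewrite ?Nl; lra.
Qed.

(** The value [h^2 / 3] is [1/(48 m^2)]. *)
Lemma quant_error_P1 (R : realType) (m : nat) (h : R) :
  (0 < m)%N -> h = (4 * m%:R)^-1 -> quant_error (P1 R) m = (h ^+ 2 / 3)%:E.
Proof.
move=> m0 hE; have N0 : 0 < m%:R :> R by rewrite ltr0n.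
have Nl : m%:R * (4 / 3 * h ^+ 3) = h ^+ 2 / 3 by rewrite hE; field; rewrite gt_eqF.
apply/le_anti/andP; split; last first.
  apply/ereal_infP => _ [S /= /andP[S1 Sm] <-].
  have S0 : S != fset0 by rewrite -cardfs_gt0.
  have := cost_ge_card S0 m0 hE Sm (erefl _).
  by rewrite distortion_P1E// lee_fin; lra.
have C0 : centers R m != fset0 by rewrite -cardfs_gt0 card_centers.
apply: ge_ereal_inf; exists (distortion (P1 R) (centers R m)).
  by exists (centers R m) => //=; rewrite card_centers m0 leqnn.
by have := cost_centers m0 hE; rewrite distortion_P1E// lee_fin Nl; lra.
Qed.

Lemma quant_error_P (R : realType) (m : nat) (h : R) :
  (1 < m)%N -> h = (4 * m%:R)^-1 -> quant_error (P R) (m + 3) = (h ^+ 2 / 6)%:E.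
Proof.
move=> m1 hE; have m0 := ltnW m1.
apply/le_anti/andP; split; last first.
  apply/ereal_infP => _ [S /= /andP[S1 Sm] <-].
  have S0 : S != fset0 by rewrite -cardfs_gt0.
  by rewrite distortion_PE// lee_fin; have [] := mixed_cost_ge S0 m1 hE Sm.
set C := (centers R m `|` D R)%fset.
have C1 : (0 < #|` C|)%N.
  by apply: leq_trans (fsubset_leq_card (fsubsetUr (centers R m) (D R))); rewrite card_D.
have C0 : C != fset0 by rewrite -cardfs_gt0.
apply: ge_ereal_inf; exists (distortion (P R) C).
  exists C => //=; rewrite C1 /=.
  by rewrite -[in leqRHS](card_centers R m) -(card_D R) -cardfsUI leq_addr.
by rewrite distortion_PE// lee_fin; exact: mixed_cost_centers.
Qed.

Unset Implicit Arguments.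

Theorem theorem2p6p5 (R : realType) (n : nat) (hn : (5 <= n)%N) :
  (forall alpha beta : {fset R},
     optimal_nmeans (P R) n alpha ->
     optimal_nmeans (P1 R) (n - 3) beta ->
     alpha = (beta `|` D R)%fset) /\
  quant_error (P R) n = (2^-1%:E * quant_error (P1 R) (n - 3))%E.
Proof.
set m := (n - 3)%N; have nE : n = (m + 3)%N by rewrite subnK// ltnW// ltnW.
(* [n >= 5] enters here: [m >= 2] is what the case of a shared nearest point requires. *)
have m1 : (1 < m)%N by rewrite ltn_subRL.
have m0 := ltnW m1.
pose h : R := (4 * m%:R)^-1; have hE : h = (4 * m%:R)^-1 by [].
have E1 := quant_error_P1 m0 hE; have E2 := quant_error_P m1 hE.
split=> [alpha beta|]; last by rewrite nE E1 E2 -EFinM; congr _%:E; field.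
rewrite nE => -[/andP[a1 a2] ea] [/andP[b1 b2] eb].
have a0 : alpha != fset0 by rewrite -cardfs_gt0.
have b0 : beta != fset0 by rewrite -cardfs_gt0.
(* Both equality cases name the same [centers R m], which links [alpha] to [beta]. *)
have [_ ->] := mixed_cost_ge a0 m1 hE a2; last first.
  by move: ea; rewrite distortion_PE// E2 => -[->].
congr (_ `|` _)%fset; apply/esym/(cost_uniform_rigid b0 m0 hE b2).
by move: eb; rewrite distortion_P1E// E1 => -[]; lra.
Qed.
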